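(* Let $\mathscr{X}$ be a Hilbert $\mathscr{A}$-module and $x, y \in \mathscr{X}$. Then the following conditions are equivalent: (i) $\forall_{a\in \mathscr{A}}\ |xa + y|^2 \geq |xa|^2$; (ii) $\forall_{a\in \mathscr{A}}\ |xa + y| \geq |xa|$; (iii) $\forall_{a\in \mathscr{A}}\ \|xa + y\| \geq \|xa\|$; (iv) $x\perp y$, i.e. $\langle x, y\rangle = 0$. Moreover, each of the conditions (i)–(iv) is equivalent to each of the following three: (v) $\forall_{a\in \mathscr{A}}\ |ya + x|^2 \geq |ya|^2$; (vi) $\forall_{a\in \mathscr{A}}\ |ya + x| \geq |ya|$; (vii) $\forall_{a\in \mathscr{A}}\ \|ya + x\| \geq \|ya\|$.
   Context: $\mathscr{A}$ is a $C^*$-algebra and $\mathscr{X}$ is a (right) Hilbert $\mathscr{A}$-module with $\mathscr{A}$-valued inner product $\langle\cdot,\cdot\rangle$ (linear and $\mathscr{A}$-linear in the second variable, $\langle x, y\rangle=\langle y, x\rangle^*$), complete with respect to the norm $\|x\| = \sqrt{\|\langle x, x\rangle\|}$. For $z\in\mathscr{X}$, $|z|$ denotes the unique positive square root of $\langle z, z\rangle\in\mathscr{A}$. Inequalities between elements of $\mathscr{A}$ refer to the order $a\geq b \iff a-b$ is positive (of the form $c^*c$). The relation $x\perp y$ means $\langle x, y\rangle = 0$; it is symmetric. *)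

(* Defs.v *)
From HB Require Import structures.
From mathcomp Require Import all_boot all_order all_algebra.
From mathcomp Require Import complex.
From mathcomp Require Import reals.
From Stdlib Require Import ClassicalEpsilon.
Set Implicit Arguments. Unset Strict Implicit. Unset Printing Implicit Defensive.
Import Order.TTheory GRing.Theory Num.Theory.
Local Open Scope ring_scope.
Local Open Scope complex_scope.

Definition complete_wrt (R : realType) (V : zmodType) (nrm : V -> R) : Prop :=
  forall u : nat -> V,
    (forall e : R, 0 < e -> exists N : nat, forall m n : nat,
        (N <= m)%N -> (N <= n)%N -> nrm (u m - u n) < e) ->
    exists l : V, forall e : R, 0 < e -> exists N : nat, forall n : nat,
        (N <= n)%N -> nrm (u n - l) < e.

Record is_cstar (R : realType) (A : lmodType R[i])
    (mul : A -> A -> A) (star : A -> A) (nrm : A -> R) : Prop := {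
  cs_mulA : forall a b c, mul a (mul b c) = mul (mul a b) c;
  cs_mulDl : forall a b c, mul (a + b) c = mul a c + mul b c;
  cs_mulDr : forall a b c, mul a (b + c) = mul a b + mul a c;
  cs_mulZl : forall (k : R[i]) a b, mul (k *: a) b = k *: mul a b;
  cs_mulZr : forall (k : R[i]) a b, mul a (k *: b) = k *: mul a b;
  cs_starD : forall a b, star (a + b) = star a + star b;
  cs_starZ : forall (k : R[i]) a, star (k *: a) = k^* *: star a;
  cs_starK : forall a, star (star a) = a;
  cs_starM : forall a b, star (mul a b) = mul (star b) (star a);
  cs_norm_eq0 : forall a, nrm a = 0 -> a = 0;
  cs_norm_ge0 : forall a, 0 <= nrm a;
  cs_normD : forall a b, nrm (a + b) <= nrm a + nrm b;
  cs_normZ : forall (k : R[i]) a, (nrm (k *: a))%:C = `|k| * (nrm a)%:C;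
  cs_normM : forall a b, nrm (mul a b) <= nrm a * nrm b;
  cs_cstar : forall a, nrm (mul (star a) a) = nrm a ^+ 2;
  cs_complete : complete_wrt nrm }.

Record cstar_algebra (R : realType) := CStarAlgebra {
  ca_car :> lmodType R[i];
  ca_mul : ca_car -> ca_car -> ca_car;
  ca_star : ca_car -> ca_car;
  ca_norm : ca_car -> R;
  ca_ax : is_cstar ca_mul ca_star ca_norm }.

Section CStar.
Variables (R : realType) (A : cstar_algebra R).

Definition cpos (a : A) : Prop := exists c : A, a = ca_mul (ca_star c) c.
Definition cge (a b : A) : Prop := cpos (a - b).

End CStar.

Record is_hilbert_module (R : realType) (A : cstar_algebra R) (X : lmodType R[i])
    (act : X -> A -> X) (ip : X -> X -> A) : Prop := {
  hm_actA : forall x a b, act (act x a) b = act x (ca_mul a b);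
  hm_actDl : forall x y a, act (x + y) a = act x a + act y a;
  hm_actDr : forall x a b, act x (a + b) = act x a + act x b;
  hm_actZl : forall (k : R[i]) x a, act (k *: x) a = k *: act x a;
  hm_actZr : forall (k : R[i]) x a, act x (k *: a) = k *: act x a;
  hm_ipD : forall x y z, ip x (y + z) = ip x y + ip x z;
  hm_ipZ : forall (k : R[i]) x y, ip x (k *: y) = k *: ip x y;
  hm_ipA : forall x y a, ip x (act y a) = ca_mul (ip x y) a;
  hm_ip_sym : forall x y, ip x y = ca_star (ip y x);
  hm_ip_pos : forall x, cpos (ip x x);
  hm_ip_eq0 : forall x, ip x x = 0 -> x = 0;
  hm_complete : complete_wrt (fun x => Num.sqrt (ca_norm (ip x x))) }.

Record hilbert_module (R : realType) (A : cstar_algebra R) := HilbertModule {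
  hm_car :> lmodType R[i];
  hm_act : hm_car -> A -> hm_car;
  hm_ip : hm_car -> hm_car -> A;
  hm_ax : is_hilbert_module hm_act hm_ip }.

Section HM.
Variables (R : realType) (A : cstar_algebra R) (X : hilbert_module A).

Definition hnorm (z : X) : R := Num.sqrt (ca_norm (hm_ip z z)).

(* |z| = the unique positive square root of <z,z> (chosen by Hilbert's epsilon;
   existence and uniqueness hold in every C*-algebra) *)
Definition is_abs (z : X) (p : A) : Prop := cpos p /\ ca_mul p p = hm_ip z z.
Definition habs (z : X) : A := epsilon (inhabits (0 : A)) (is_abs z).

Definition horth (x y : X) : Prop := hm_ip x y = 0.

End HM.

(* Main.v *)
(* For x orthogonal to y, |xa + y|^2 = |xa|^2 + |y|^2, which gives the square
   inequality, and operator monotonicity of the square root and of the norm on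
   positive elements yields the other two. Conversely the norm inequality at
   - t <x,y>, t large, forces x<x,y> = 0.

   The C*-algebra facts needed (the elements c^*c form a cone on which square
   roots exist, the square root and the norm being monotone) are proved in the
   unitization without spectral theory: h is positive when it is self-adjoint
   with |t - h| <= t for some t > 0, square roots come from a power series, and
   spectral radius arguments are replaced by |x^(2^m)| = |x|^(2^m) for
   self-adjoint x. *)
Require Import Defs.
From HB Require Import structures.
From mathcomp Require Import all_boot all_order all_algebra.
From mathcomp Require Import complex.
From mathcomp Require Import reals classical_sets.
From mathcomp Require Import ring lra.
Set Implicit Arguments. Unset Strict Implicit. Unset Printing Implicit Defensive.
Import Order.TTheory GRing.Theory Num.Theory.
Local Open Scope ring_scope.
Local Open Scope complex_scope.

(** * Two facts on real sequences *)

(** The sequence [r] is nondecreasing and bounded, so it comes within [e] of its supremum; from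
    there on the increments of [u], dominated by those of [r], telescope to less than [e]. *)
Lemma bounded_incr_cauchy (R : realType) (V : zmodType) (nrm : V -> R)
    (u : nat -> V) (r : nat -> R) (B : R) :
    nrm 0 = 0 -> (forall a b, nrm (a + b) <= nrm a + nrm b) ->
    (forall a, nrm (- a) = nrm a) ->
    (forall n, nrm (u n.+1 - u n) <= r n.+1 - r n) -> (forall n, r n <= B) ->
  forall e : R, 0 < e -> exists N : nat, forall m n : nat,
        (N <= m)%N -> (N <= n)%N -> nrm (u m - u n) < e.
Proof.
move=> nrm0 nrmD nrmN ur rB e e0.
have inc k n : nrm (u (n + k)%N - u n) <= r (n + k)%N - r n.
  elim: k => [|k IH]; first by rewrite addn0 !subrr nrm0.
  rewrite addnS; have := ur (n + k)%N.
  have := nrmD (u (n + k).+1 - u (n + k)%N) (u (n + k)%N - u n).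
  rewrite addrA subrK; lra.
have supr : has_sup (range r).
  by split; [exists (r 0); exists 0 | exists B => _ [n _ <-]].
have [_ [N _ <-] rN] := sup_adherent e0 supr.
exists N.
have mon n m : (N <= n)%N -> (n <= m)%N -> nrm (u m - u n) < e.
  move=> Nn /subnKC <-; apply: le_lt_trans (inc _ _) _.
  have h1 : r (n + (m - n))%N <= sup (range r).
    by apply: ub_le_sup; [exact: supr.2 | exists (n + (m - n))%N].
  have h2 : r N <= r n.
    rewrite -(subnKC Nn) -subr_ge0; apply: le_trans (inc _ _).
    (* The norm is nonnegative because 0 = |x - x| <= 2 |x|. *)
    set x := u _ - _; have := nrmD x (- x); rewrite subrr nrm0 nrmN; lra.
  lra.
move=> m n Nm Nn; case: (leqP n m) => [|/ltnW]; first exact: mon.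
by move=> mn; rewrite -nrmN opprB; exact: mon.
Qed.

Lemma bernoulli_le (R : realFieldType) (x : R) (n : nat) :
  0 <= x -> 1 + n%:R * x <= (1 + x) ^+ n.
Proof.
move=> x0; elim: n => [|n IH]; first by rewrite expr0; lra.
have h : (1 + n%:R * x) * (1 + x) <= (1 + x) ^+ n * (1 + x) by rewrite ler_wpM2r //; lra.
rewrite exprSr; apply: le_trans h; rewrite -natr1.
have : 0 <= (n%:R : R) * (x * x) by rewrite !mulr_ge0. 
by move: (n%:R : R) => z; lra.
Qed.

(** If a = 1 + y with y > 0, Bernoulli gives a^(2N) >= (N y)^2 for N = 2^j, which exceeds 2 C N once
    N y^2 > 2 C. This replaces taking 2^m-th roots in a spectral radius argument. *)
Lemma pow2_growth_le1 (R : realType) (a C : R) : 0 <= a ->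
  (forall m, a ^+ (2 ^ m) <= C * (2 ^ m)%:R) -> a <= 1.
Proof.
move=> a0 h; rewrite leNgt; apply/negP => a1.
pose y := a - 1; have y0 : 0 < y by rewrite subr_gt0.
have C0 : 0 <= C by have := h 0%N; rewrite expn0 expr1; lra.
have yy0 : 0 < y * y by rewrite mulr_gt0.
pose j := Num.bound (2 * C / (y * y)); pose N : R := (2 ^ j)%:R.
have NC : 2 * C < N * (y * y).
  rewrite -ltr_pdivrMr //; apply: lt_le_trans (archi_boundP _) _.
    by rewrite divr_ge0 ?mulr_ge0 // ltW.
  by rewrite ler_nat ltnW // ltn_expl.
have N0 : 0 < N by rewrite ltr0n expn_gt0.
have := h j.+1; rewrite expnS mulnC exprM natrM -/N.
have := bernoulli_le (2 ^ j) (ltW y0); rewrite -/N.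
have -> : 1 + y = a by rewrite addrC subrK.
move: (a ^+ (2 ^ j)) => P NP PC.
have NyP : (N * y) ^+ 2 <= P ^+ 2 by rewrite ler_sqr ?nnegrE; have := mulr_gt0 N0 y0; lra.
have : N * (2 * C) < N * (N * (y * y)) by rewrite ltr_pM2l.
move: NyP PC; rewrite expr2; lra.
Qed.

(** * Norm limits in a C*-algebra *)

Section Basic.
Variables (R : realType) (A : lmodType R[i]).
Variables (mul : A -> A -> A) (star : A -> A) (nrm : A -> R).
Hypothesis ax : is_cstar mul star nrm.

Lemma cs_normZr (t : R) a : nrm (t%:C *: a) = `|t| * nrm a.
Proof.
by apply: complexI; rewrite (cs_normZ ax) normc_def /= expr0n addr0 sqrtr_sqr rmorphM.
Qed.

Lemma cs_norm0 : nrm 0 = 0.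
Proof. by have := cs_normZr 0 0; rewrite rmorph0 scale0r normr0 mul0r. Qed.

Lemma cs_normN a : nrm (- a) = nrm a.
Proof.
by rewrite -scaleN1r -(rmorph1 (real_complex R)) -rmorphN cs_normZr normrN1 mul1r.
Qed.

Lemma cs_normB a b : nrm (a - b) <= nrm a + nrm b.
Proof. by rewrite -(cs_normN b); exact: (cs_normD ax). Qed.

(** |b|^2 = |b^* b| <= |b^*| |b| gives |b| <= |b^*|; applying this to b^* as well gives equality. *)
Lemma cs_norm_star a : nrm (star a) = nrm a.
Proof.
suff le b : nrm b <= nrm (star b).
  by apply/le_anti; rewrite le andbT -{2}(cs_starK ax a) le.
have := cs_normM ax (star b) b; rewrite (cs_cstar ax) expr2.
have := cs_norm_ge0 ax b; rewrite le_eqVlt => /predU1P [<- _|b0].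
  exact: cs_norm_ge0 ax _.
by rewrite ler_pM2r.
Qed.

Lemma cs_starZr (t : R) a : star (t%:C *: a) = t%:C *: star a.
Proof.
by rewrite (cs_starZ ax) conj_Creal //; apply/complex_realP; exists t.
Qed.

Lemma cs_star0 : star 0 = 0.
Proof. by have := cs_starZr 0 0; rewrite rmorph0 !scale0r. Qed.

Lemma cs_starN a : star (- a) = - star a.
Proof. by apply/eqP; rewrite -addr_eq0 -(cs_starD ax) addNr cs_star0. Qed.

Lemma cs_starB a b : star (a - b) = star a - star b.
Proof. by rewrite (cs_starD ax) cs_starN. Qed.

Lemma cs_mulN a b : mul a (- b) = - mul a b.
Proof.
by rewrite -scaleN1r (cs_mulZr ax) scaleN1r.
Qed.

Lemma cs_mulNl a b : mul (- a) b = - mul a b.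
Proof. by rewrite -scaleN1r (cs_mulZl ax) scaleN1r. Qed.

Lemma cs_mul0 a : mul a 0 = 0.
Proof. by have := cs_mulZr ax 0 a 0; rewrite !scale0r. Qed.

Lemma cs_mul0l a : mul 0 a = 0.
Proof. by have := cs_mulZl ax 0 0 a; rewrite !scale0r. Qed.

Lemma cs_cstar_eq0 a : mul (star a) a = 0 -> a = 0.
Proof.
move=> /(congr1 nrm); rewrite (cs_cstar ax) cs_norm0 => /eqP.
by rewrite expf_eq0 /= => /eqP; exact: cs_norm_eq0 ax _.
Qed.

Lemma cs_sa_sqr a : star a = a -> nrm (mul a a) = nrm a ^+ 2.
Proof. by move=> {1}<-; exact: cs_cstar ax _. Qed.

Definition cvgn (u : nat -> A) (l : A) := forall e : R, 0 < e ->
  exists N : nat, forall n : nat, (N <= n)%N -> nrm (u n - l) < e.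

Lemma cvgn_norm_le u l M : cvgn u l -> (forall n, nrm (u n) <= M) -> nrm l <= M.
Proof.
move=> ul uM; apply/ler_addgt0Pr => e e0; have [N /(_ N (leqnn _)) h] := ul e e0.
have := cs_normB (u N) (u N - l); rewrite opprB addrCA subrr addr0.
have := uM N; lra.
Qed.

Lemma eq_cvgn u v l : u =1 v -> cvgn u l -> cvgn v l.
Proof. by move=> uv ul e /ul [N h]; exists N => n; rewrite -uv; exact: h. Qed.

Lemma cvgn_cst l : cvgn (fun=> l) l.
Proof. by move=> e e0; exists 0%N => n _; rewrite subrr cs_norm0. Qed.

Lemma cvgn_shift u l : cvgn u l -> cvgn (fun n => u n.+1) l.
Proof. by move=> ul e /ul [N h]; exists N => n /leqW; exact: h. Qed.

Lemma cvgnN u l : cvgn u l -> cvgn (fun n => - u n) (- l).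
Proof. by move=> ul e /ul [N h]; exists N => n /h; rewrite -opprD cs_normN. Qed.

Lemma cvgnD u v l m : cvgn u l -> cvgn v m -> cvgn (fun n => u n + v n) (l + m).
Proof.
move=> ul vm e e0; have e20 : 0 < e / 2 by lra.
have [[N hN] [M hM]] := (ul _ e20, vm _ e20); exists (maxn N M) => n.
rewrite geq_max => /andP[/hN h1 /hM h2]; rewrite opprD addrACA.
have := cs_normD ax (u n - l) (v n - m); lra.
Qed.

Lemma cvgn_uniq u l m : cvgn u l -> cvgn u m -> l = m.
Proof.
move=> ul um; apply/eqP; rewrite -subr_eq0; apply/eqP; apply: (cs_norm_eq0 ax).
have h : cvgn (fun=> 0) (l - m).
  by apply: eq_cvgn (cvgnD ul (cvgnN um)) => n; rewrite subrr.
by apply/le_anti; rewrite (cs_norm_ge0 ax) (cvgn_norm_le h) // => _; rewrite cs_norm0.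
Qed.

Lemma cvgn_star u l : cvgn u l -> cvgn (fun n => star (u n)) (star l).
Proof. by move=> ul e /ul [N h]; exists N => n /h; rewrite -cs_starB cs_norm_star. Qed.

Lemma cvgnM u v l m : cvgn u l -> cvgn v m -> cvgn (fun n => mul (u n) (v n)) (mul l m).
Proof.
move=> ul vm e e0; pose K := 1 + nrm l + nrm m.
have [l0 m0] := (cs_norm_ge0 ax l, cs_norm_ge0 ax m).
have K0 : 0 < K by rewrite /K; lra.
(* Since d <= 1, the product of the two errors is below d, so the three terms of the expansion below
   total less than d (1 + |l| + |m|) <= e. *)
have [d [d0 d1 dK]] : exists d, [/\ 0 < d, d <= 1 & d * K <= e].
  case: (lerP (e / K) 1) => h.
    by exists (e / K); rewrite divr_gt0 // h divfK ?gt_eqF.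
  by exists 1; rewrite mul1r; split=> //; move: h; rewrite ltr_pdivlMr // mul1r => /ltW.
have [[N hN] [M hM]] := (ul _ d0, vm _ d0); exists (maxn N M) => n.
rewrite geq_max => /andP[/hN h1 /hM h2].
have -> : mul (u n) (v n) - mul l m =
    mul (u n - l) (v n - m) + mul l (v n - m) + mul (u n - l) m.
  by rewrite -(cs_mulDl ax) subrK (cs_mulDr ax) (cs_mulDl ax) cs_mulN cs_mulNl addrA subrK.
have := cs_normD ax (mul (u n - l) (v n - m) + mul l (v n - m)) (mul (u n - l) m).
have := cs_normD ax (mul (u n - l) (v n - m)) (mul l (v n - m)).
have := cs_normM ax (u n - l) (v n - m); have := cs_normM ax l (v n - m).
have := cs_normM ax (u n - l) m.
have := cs_norm_ge0 ax (u n - l); have := cs_norm_ge0 ax (v n - m).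
rewrite /K in dK; move: (nrm (u n - l)) (nrm (v n - m)) h1 h2 => x y h1 h2 y0 x0.
have xy : x * y <= d by nra.
have ly : nrm l * y <= nrm l * d by nra.
have xm : x * nrm m <= d * nrm m by nra.
have xy' : x * y < d by nra.
lra.
Qed.

Lemma cvgn_comm u l z : cvgn u l -> (forall n, mul z (u n) = mul (u n) z) ->
  mul z l = mul l z.
Proof.
move=> ul h; apply: cvgn_uniq (cvgnM (cvgn_cst z) ul) _.
by apply: eq_cvgn (cvgnM ul (cvgn_cst z)) => n; rewrite h.
Qed.

Lemma cvgn_sa u l : cvgn u l -> (forall n, star (u n) = u n) -> star l = l.
Proof.
by move=> ul h; apply: cvgn_uniq (cvgn_star ul) _; apply: eq_cvgn ul => n; rewrite h.
Qed.

Lemma cvgn_bounded_incr u (r : nat -> R) B :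
  (forall n, nrm (u n.+1 - u n) <= r n.+1 - r n) -> (forall n, r n <= B) ->
  exists l, cvgn u l.
Proof.
move=> h1 h2; apply: (cs_complete ax); apply: bounded_incr_cauchy h1 h2.
- exact: cs_norm0.
- exact: cs_normD ax.
- exact: cs_normN.
Qed.

End Basic.
(** * Positivity in a unital C*-algebra *)

Section Unital.
Variables (R : realType) (U : algType R[i]) (star : U -> U) (nrm : U -> R).
Hypothesis ax : is_cstar (A := U) *%R star nrm.

Local Notation "t *r x" := (t%:C *: x) (at level 40).

Lemma scrA (s t : R) (x : U) : s *r (t *r x) = (s * t) *r x.
Proof. by rewrite scalerA -rmorphM. Qed.

Lemma scrDl (s t : R) (x : U) : (s + t) *r x = s *r x + t *r x.
Proof. by rewrite rmorphD scalerDl. Qed.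

Lemma scr1 (x : U) : 1 *r x = x.
Proof. by rewrite rmorph1 scale1r. Qed.

Lemma scrKl (t : R) (x : U) : t != 0 -> t^-1 *r (t *r x) = x.
Proof. by move=> t0; rewrite scrA mulVf // scr1. Qed.

Lemma scrK (t : R) (x : U) : t != 0 -> t *r (t^-1 *r x) = x.
Proof. by move=> t0; rewrite scrA mulfV // scr1. Qed.

Lemma scrM (s t : R) (x y : U) : (s *r x) * (t *r y) = (s * t) *r (x * y).
Proof. by rewrite -scalerAl -scalerAr scrA. Qed.

Lemma half_double (x : U) : 2^-1 *r (x + x) = x.
Proof. by rewrite scalerDr -scrDl -[in RHS](scr1 x); congr (_%:C *: _); lra. Qed.

Let nZ := cs_normZr ax.
Let nD := cs_normD ax.
Let nM := cs_normM ax.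
Let n_ge0 := cs_norm_ge0 ax.
Let sZ := cs_starZr ax.
Let sD := cs_starD ax.
Let sM := cs_starM ax.
Let sK := cs_starK ax.

Lemma cs_normZr_ge0 (t : R) x : 0 <= t -> nrm (t *r x) = t * nrm x.
Proof. by move=> t0; rewrite nZ ger0_norm. Qed.

Lemma star1 : star 1 = 1.
Proof. by have := sM (star 1) 1; rewrite !mulr1 !sK mulr1. Qed.

Lemma norm1_le : nrm 1 <= 1.
Proof. by have := cs_sa_sqr ax star1; have := n_ge0 1; rewrite mulr1; nra. Qed.

Lemma normM_le1 x y : nrm x <= 1 -> nrm y <= 1 -> nrm (x * y) <= 1.
Proof. by have := nM x y; have := n_ge0 x; have := n_ge0 y; nra. Qed.

(* 1 - s is the limit of w_{n+1} = (k + w_n^2) / 2, w_0 = 0, whose increments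
   are dominated by those of the same scalar iteration with k = 1. *)
Lemma sqrt_one_minus k : star k = k -> nrm k <= 1 ->
  exists s, [/\ star s = s, s * s = 1 - k, nrm (1 - s) <= 1 &
    forall z, z * k = k * z -> z * s = s * z].
Proof.
move=> sk nk.
pose w := fix w n := if n is n'.+1 then 2^-1 *r (k + w n' * w n') else 0.
pose r := fix r n : R := if n is n'.+1 then 2^-1 * (1 + r n' * r n') else 0.
have wS n : w n.+1 = 2^-1 *r (k + w n * w n) by [].
have rS n : r n.+1 = 2^-1 * (1 + r n * r n) by [].
have r01 n : 0 <= r n <= 1 by elim: n => [|n /andP[? ?]] /=; nra.
have wr n : nrm (w n) <= r n.
  elim: n => [|n IH] /=; first by rewrite (cs_norm0 ax).
  rewrite cs_normZr_ge0; last lra.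
  have := nD k (w n * w n); have := nM (w n) (w n); have := n_ge0 (w n).
  by move: IH; have /andP[] := r01 n; nra.
have dw n : nrm (w n.+1 - w n) <= r n.+1 - r n.
  elim: n => [|n IH].
    by rewrite /= mul0r !addr0 !subr0 mulr0 addr0 mulr1 cs_normZr_ge0 //; lra.
  (* Noncommutative form of x^2 - y^2 = x (x - y) + (x - y) y. *)
  have -> : w n.+2 - w n.+1 =
      2^-1 *r (w n.+1 * (w n.+1 - w n) + (w n.+1 - w n) * w n).
    rewrite mulrBr mulrBl addrA subrK.
    by rewrite (wS n.+1) [X in _ - X]wS -scalerBr opprD addrACA subrr add0r.
  rewrite cs_normZr_ge0; last lra.
  have -> : r n.+2 - r n.+1 = 2^-1 * (r n.+1 * (r n.+1 - r n) + (r n.+1 - r n) * r n).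
    by rewrite (rS n.+1) [X in _ - X]rS; ring.
  rewrite ler_pM2l; last lra.
  apply: le_trans (nD _ _) _; apply: lerD; apply: le_trans (nM _ _) _; exact: ler_pM.
have [l wl] := cvgn_bounded_incr ax dw (fun n => proj2 (andP (r01 n))).
have sl : star l = l.
  apply: (cvgn_sa ax wl); elim=> [|n IH] /=; first exact: cs_star0 ax.
  by rewrite sZ sD sM IH sk.
have cl z : z * k = k * z -> z * l = l * z.
  move=> zk; apply: (cvgn_comm ax wl); elim=> [|n IH] /=; first by rewrite mulr0 mul0r.
  by rewrite -scalerAr -scalerAl mulrDr mulrDl zk mulrA IH -mulrA IH mulrA.
(* The fixed point equation 2 l = k + l^2 is the same as (1 - l)^2 = 1 - k. *)
have ll : l + l = k + l * l.
  have h1 := cvgn_shift wl.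
  apply: (cvgn_uniq ax (cvgnD ax h1 h1)).
  apply: eq_cvgn (cvgnD ax (cvgn_cst ax k) (cvgnM ax wl wl)) => n /=.
  by rewrite -scrDl -[LHS]scr1; congr (_%:C *: _); lra.
exists (1 - l); split.
- by rewrite (cs_starB ax) star1 sl.
- have -> : k = l + l - l * l by rewrite ll addrK.
  by rewrite mulrBr mulr1 mulrBl mul1r !opprB opprD -addrA (addrCA (- l)).
- rewrite subKr; apply: (cvgn_norm_le ax wl) => n.
  by apply: le_trans (wr n) _; case/andP: (r01 n).
- by move=> z /cl h; rewrite mulrBr mulrBl h mulr1 mul1r.
Qed.

(* p + i q is unitary *)
Lemma norm_cos_le1 p q : star p = p -> star q = q -> p * q = q * p ->
  p * p + q * q = 1 -> nrm p <= 1.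
Proof.
move=> sp sq pq h; pose u := p + 'i *: q.
have su : star u = p - 'i *: q.
  by rewrite sD (cs_starZ ax) conjCi scaleNr sp sq.
have nu : nrm u <= 1.
  have e : star u * u = 1.
    rewrite su mulrDr !mulrBl -!scalerAl -!scalerAr pq.
    rewrite addrA subrK scalerA mulCii scaleN1r opprK //.
  have := cs_cstar ax u; rewrite e; have := norm1_le; have := n_ge0 u; nra.
have -> : p = 2^-1 *r (u + star u).
  by rewrite su addrACA subrr addr0 half_double.
rewrite cs_normZr_ge0; last lra.
by have := nD u (star u); rewrite (cs_norm_star ax); lra.
Qed.

(** * The cone of nonnegative elements *)

(** For self-adjoint [h] the bound means that the spectrum lies in [0, 2t]; in this form sums are
    handled by the triangle inequality alone. *)
Definition nonneg h := star h = h /\ exists2 t : R, 0 < t & nrm (t *r 1 - h) <= t.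

Lemma nonneg0 : nonneg 0.
Proof.
split; first exact: cs_star0 ax.
by exists 1; rewrite ?ltr01 // subr0 scr1 norm1_le.
Qed.

Lemma nonnegD a b : nonneg a -> nonneg b -> nonneg (a + b).
Proof.
move=> [sa [s s0 ns]] [sb [t t0 nt]]; split; first by rewrite sD sa sb.
exists (s + t); first by rewrite addr_gt0.
rewrite scrDl opprD addrACA; apply: le_trans (nD _ _) _; exact: lerD.
Qed.

Lemma nonnegZ (c : R) a : 0 <= c -> nonneg a -> nonneg (c *r a).
Proof.
rewrite le_eqVlt => /predU1P [<- _|c0 [sa [t t0 nt]]].
  by rewrite rmorph0 scale0r; exact: nonneg0.
split; first by rewrite sZ sa.
exists (c * t); first by rewrite mulr_gt0.
by rewrite -scrA -scalerBr cs_normZr_ge0 ?(ltW c0) // ler_pM2l.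
Qed.

Lemma nonneg_norm_sub h (b : R) : star h = h -> 0 < b -> nrm h <= b -> nonneg (b *r 1 - h).
Proof.
move=> sh b0 nh; split; first by rewrite (cs_starB ax) sZ star1 sh.
by exists b; rewrite // subKr.
Qed.

(** The element k = 1 - h/t has norm at most 1, so 1 - k = h/t has a square root s with |1 - s| <=
    1, and this last bound makes sqrt(t) s nonnegative. *)
Lemma nonneg_sqrt h : nonneg h -> exists p, [/\ nonneg p, p * p = h &
  forall z, z * h = h * z -> z * p = p * z].
Proof.
move=> [sh [t t0 nt]]; have tn0 : t != 0 by rewrite gt_eqF.
pose k := 1 - t^-1 *r h.
have kE : k = t^-1 *r (t *r 1 - h) by rewrite scalerBr scrKl.
have sk : star k = k by rewrite (cs_starB ax) sZ star1 sh.
have nk : nrm k <= 1.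
  by rewrite kE cs_normZr_ge0 ?invr_ge0 ?(ltW t0) // mulrC ler_pdivrMr // mul1r.
have [s [ss sE ns cs]] := sqrt_one_minus sk nk.
have st0 : 0 < Num.sqrt t by rewrite sqrtr_gt0.
exists (Num.sqrt t *r s); split.
- split; first by rewrite sZ ss.
  exists (Num.sqrt t) => //; rewrite -scalerBr cs_normZr_ge0 ?(ltW st0) //.
  by rewrite -[leRHS]mulr1 ler_pM2l.
- by rewrite scrM -expr2 sqr_sqrtr ?(ltW t0) // sE subKr scrK.
- move=> z zh; rewrite -scalerAr -scalerAl cs //.
  by rewrite mulrBr mulrBl mul1r mulr1 -scalerAr -scalerAl zh.
Qed.

(** After scaling [p] to [g] with |g| <= 1, a self-adjoint root s of 1 - g^2 commutes with g; then
    s^2 + g^2 = 1 forces |s| <= 1, hence |1 - g^2| = |s^2| <= 1. *)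
Lemma nonneg_sqr p : star p = p -> nonneg (p * p).
Proof.
move=> sp; pose M := nrm p + 1; have M0 : 0 < M by have := n_ge0 p; rewrite /M; lra.
pose g := M^-1 *r p; have sg : star g = g by rewrite sZ sp.
have pE : p = M *r g by rewrite scrK ?gt_eqF.
have ng : nrm g <= 1.
  by rewrite cs_normZr_ge0 ?invr_ge0 ?(ltW M0) // mulrC ler_pdivrMr // /M; lra.
have sgg : star (g * g) = g * g by rewrite sM sg.
have [s [ss sE _ cs]] := sqrt_one_minus sgg (normM_le1 ng ng).
have sg' : s * g = g * s by rewrite cs // mulrA.
have ns : nrm s <= 1 by apply: (norm_cos_le1 ss sg sg'); rewrite sE subrK.
rewrite pE scrM; apply: nonnegZ; first by rewrite mulr_ge0 ?(ltW M0).
split=> //; exists 1; rewrite ?ltr01 // scr1 -sE; exact: normM_le1.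
Qed.

(** The roots p of a/b and q of 1 - a/b commute and satisfy p^2 + q^2 = 1, so |p| <= 1 by
    [norm_cos_le1] and |a| = b |p^2| <= b. *)
Lemma nonneg_norm_le a (b : R) : nonneg a -> nonneg (b *r 1 - a) -> 0 < b -> nrm a <= b.
Proof.
move=> a0 ba b0; have bn0 : b != 0 by rewrite gt_eqF.
have bV : 0 <= b^-1 by rewrite invr_ge0 ltW.
have [p [[sp _] pE cp]] := nonneg_sqrt (nonnegZ bV a0).
have [q [[sq _] qE cq]] := nonneg_sqrt (nonnegZ bV ba).
have bE : b^-1 *r (b *r 1 - a) = 1 - p * p by rewrite scalerBr scrKl // pE.
have pq : p * q = q * p by rewrite cq // bE mulrBr mulrBl mul1r mulr1 mulrA.
have np : nrm p <= 1.
  by apply: (norm_cos_le1 sp sq pq); rewrite qE bE addrC subrK.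
have := normM_le1 np np; rewrite pE cs_normZr_ge0 // mulrC ler_pdivrMr // mul1r.
exact.
Qed.

Lemma nonneg_antisym h : nonneg h -> nonneg (- h) -> h = 0.
Proof.
move=> h0 hN; apply: (cs_norm_eq0 ax); apply/le_anti; rewrite n_ge0 andbT.
apply/ler_addgt0Pr => e e0; rewrite add0r; apply: nonneg_norm_le => //.
apply: nonnegD hN; rewrite -[_ *r _]subr0; apply: nonneg_norm_sub => //.
  exact: cs_star0 ax.
by rewrite (cs_norm0 ax) ltW.
Qed.

(** Writes |b| + e - a as the sum of |b| + e - b and b - a; the [e] keeps the bound positive when b
    = 0. *)
Lemma nonneg_le_norm a b : nonneg a -> nonneg (b - a) -> nrm a <= nrm b.
Proof.
move=> a0 ba; apply/ler_addgt0Pr => e e0.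
have b0 : 0 < nrm b + e by have := n_ge0 b; lra.
apply: nonneg_norm_le => //; rewrite -(subrK b (_ *r _)) -addrA.
apply: (nonnegD _ ba); apply: nonneg_norm_sub => //; last by rewrite lerDl ltW.
by rewrite -(subrK a b) sD; case: ba => -> _; case: a0 => ->.
Qed.

Lemma sa_pow x n : star x = x -> star (x ^+ n) = x ^+ n.
Proof.
move=> sx; elim: n => [|n IH]; first by rewrite !expr0 star1.
by rewrite exprSr sM IH sx -exprS -exprSr.
Qed.

Lemma norm_sa_pow2 x m : star x = x -> nrm (x ^+ (2 ^ m)) = nrm x ^+ (2 ^ m).
Proof.
move=> sx; elim: m => [|m IH]; first by rewrite expn0 !expr1.
by rewrite expnSr !exprM -IH expr2 (cs_sa_sqr ax) ?sa_pow.
Qed.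

(** Frees the constant hidden in [nonneg]: every positive bound of |h| can serve as [t]. *)
Lemma nonneg_norm_subs h (b : R) : nonneg h -> 0 < b -> nrm h <= b -> nrm (b *r 1 - h) <= b.
Proof.
move=> h0 b0 nh; apply: nonneg_norm_le => //; last by rewrite subKr.
by apply: nonneg_norm_sub => //; case: h0.
Qed.

(* (1 - d^* d)^n = 1 - d^* G_n d with |G_n| <= n, so the norms of the powers of
   the self-adjoint 1 - d^* d grow at most linearly. *)
Lemma norm_sub_cstar_swap d : nrm d <= 1 -> nrm (1 - d * star d) <= 1 ->
  nrm (1 - star d * d) <= 1.
Proof.
move=> nd ndd; set x := 1 - star d * d.
have sx : star x = x by rewrite (cs_starB ax) star1 sM sK.
pose G := fix G n := if n is n'.+1 then 1 + (1 - d * star d) * G n' else 0.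
have GS n : G n.+1 = 1 + (1 - d * star d) * G n by [].
have nG n : nrm (G n) <= n%:R.
  elim: n => [|n IH]; first by rewrite (cs_norm0 ax).
  rewrite GS -natr1; have := nD 1 ((1 - d * star d) * G n); have := norm1_le.
  have := nM (1 - d * star d) (G n); have := n_ge0 (G n).
  by have := n_ge0 (1 - d * star d); move: IH ndd; nra.
have xG n : x ^+ n = 1 - star d * G n * d.
  elim: n => [|n IH]; first by rewrite expr0 mulr0 mul0r subr0.
  (* This intertwining relation trades powers of 1 - d^* d for powers of 1 - d d^*. *)
  have xd : x * star d = star d * (1 - d * star d).
    by rewrite /x mulrBl mulrBr mul1r mulr1 mulrA.
  rewrite exprS IH mulrBr mulr1 2!(mulrA x) xd GS [in RHS]mulrDr mulr1 [in RHS]mulrDl.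
  by rewrite opprD addrA !mulrA.
(* The constant 2 comes from |x^n| <= 1 + n <= 2 n with n = 2^m. *)
apply: (@pow2_growth_le1 _ _ 2) => [|m]; first exact: n_ge0.
rewrite -norm_sa_pow2 // xG; apply: le_trans (cs_normB ax _ _) _.
have h1 : (1 : R) <= (2 ^ m)%:R by rewrite ler1n expn_gt0.
have := nM (star d * G (2 ^ m)%N) d; have := nM (star d) (G (2 ^ m)%N).
have := nG (2 ^ m)%N%N; have := norm1_le; have := n_ge0 d; have := n_ge0 (G (2 ^ m)%N).
rewrite (cs_norm_star ax); move: nd h1.
move: (nrm d) (nrm (G _)) ((2 ^ m)%:R : R) (nrm (star d * _)) (nrm (_ * d)).
move=> a g N s1 s2 a1 N1 g0 a0 n1 gN s1a s2a.
have : a * g <= g by nra.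
nra.
Qed.

(** Once |d| <= 1, nonnegativity of d d^* amounts to |1 - d d^*| <= 1, a bound that passes to d^* d;
    the general case follows by scaling. *)
Lemma nonneg_cstar_swap d : nonneg (d * star d) -> nonneg (star d * d).
Proof.
move=> hd; pose r := (nrm d + 1)^-1.
have n1 : 0 < nrm d + 1 by have := n_ge0 d; lra.
have r0 : 0 < r by rewrite invr_gt0.
have nd : nrm (r *r d) <= 1.
  by rewrite cs_normZr_ge0 ?(ltW r0) // mulrC ler_pdivrMr // mul1r; lra.
have nsd : nrm (star (r *r d)) <= 1 by rewrite (cs_norm_star ax).
have h : nrm (1 - star (r *r d) * (r *r d)) <= 1.
  apply: norm_sub_cstar_swap => //; rewrite -[X in X - _]scr1.
  apply: nonneg_norm_subs => //; last exact: normM_le1.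
  by rewrite sZ scrM; apply: nonnegZ => //; rewrite mulr_ge0 ?(ltW r0).
have -> : star d * d = (r^-1 * r^-1) *r (star (r *r d) * (r *r d)).
  have rn0 : r != 0 by rewrite gt_eqF.
  by rewrite sZ !scrM scrA mulrACA mulVf // mulr1 scr1.
apply: nonnegZ; first by rewrite -invfM invr_ge0 mulr_ge0 // ltW.
split; first by rewrite sM sK.
by exists 1; rewrite ?ltr01 // scr1.
Qed.

(** With the self-adjoint elements [a] and [b], which up to sign are twice the real and imaginary
    parts of [d], the sum is (a^2 + b^2) / 2. *)
Lemma nonneg_cstarD d : nonneg (star d * d + d * star d).
Proof.
pose a := d + star d; pose b := 'i *: (d - star d).
have sa : star a = a by rewrite sD sK addrC.
have sb : star b = b.
  by rewrite (cs_starZ ax) conjCi (cs_starB ax) sK scaleNr -scalerN opprB.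
have -> : star d * d + d * star d = 2^-1 *r (a * a + b * b).
  rewrite /b -scalerAl -scalerAr scalerA mulCii scaleN1r.
  rewrite !mulrDl !mulrDr !mulNr !mulrN !opprD !opprK.
  have h (x y z t : U) : x + y + (z + t) + (- x + y + (z - t)) = (z + y) + (z + y).
    have -> : x + y + (z + t) + (- x + y + (z - t)) =
      (y + x + (- x + y)) + (z + t + (z - t)) by rewrite addrACA (addrC x).
    by rewrite [y + x + _]addrA addrK [z + t + _]addrACA subrr addr0 addrACA (addrC y).
  by rewrite h half_double.
apply: nonnegZ; first lra.
by apply: nonnegD; exact: nonneg_sqr.
Qed.

(* With m = |h| and n = m - h one has n h n = - n m n, which exhibits
   (c n)^* (c n) as the opposite of a square. *)
Lemma nonneg_cstar c : nonneg (star c * c).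
Proof.
set h := star c * c; have sh : star h = h by rewrite sM sK.
have [m [m0 mE cm]] := nonneg_sqrt (nonneg_sqr sh).
have hm : h * m = m * h by apply: cm; rewrite mulrA.
have [r [[sr _] rE cr]] := nonneg_sqrt m0.
have hr : h * r = r * h by exact: cr.
have mr : m * r = r * m by exact: cr.
pose n := m - h.
have sn : star n = n by rewrite (cs_starB ax) sh; case: m0 => ->.
have nr : n * r = r * n by rewrite mulrBl mulrBr mr hr.
have hn : h * n = - (m * n) by rewrite !mulrBr -mE hm opprB.
have sz : star (r * n) = r * n by rewrite sM sr sn.
have dE : star (c * n) * (c * n) = - ((r * n) * (r * n)).
  rewrite sM sn mulrA -(mulrA n) -/h -mulrA hn mulrN -rE.
  by rewrite -{1}nr !mulrA.
have z0 := nonneg_sqr sz.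
(* For d = c n, the element - d^* d is nonnegative; adding it to d^* d + d d^* shows that d d^* is
   nonnegative, hence so is d^* d by the swap, and antisymmetry gives d^* d = 0. *)
have d0 : c * n = 0.
  apply: (cs_cstar_eq0 ax); apply: nonneg_antisym; last by rewrite dE opprK.
  apply: nonneg_cstar_swap.
  by rewrite -[X in nonneg X](addKr (star (c * n) * (c * n))) addrC dE opprK -dE;
    apply: nonnegD => //; exact: nonneg_cstarD.
have rn : r * n = 0.
  apply: (cs_cstar_eq0 ax); rewrite sz -[LHS]opprK -dE d0.
  by rewrite mulr0 oppr0.
have mn : m * n = 0 by rewrite -rE -mulrA rn mulr0.
(* It is enough that h = m, since [m] is nonnegative; and n^2 = m n - h n vanishes with m n. *)
suff : n = 0 by move/eqP; rewrite subr_eq0 => /eqP <-.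
apply: (cs_cstar_eq0 ax); rewrite sn {1}/n mulrBl hn mn opprK addr0 //.
Qed.

Lemma nonneg_conj a c : nonneg a -> nonneg (star c * a * c).
Proof.
move=> /nonneg_sqrt [p [[sp _] <- _]].
suff -> : star c * (p * p) * c = star (p * c) * (p * c) by exact: nonneg_cstar.
by rewrite sM sp !mulrA.
Qed.

(** Neumann series: q + e = T (1 - k) with T = t + e and |k| <= t / T < 1; [g] lists the partial
    sums of the powers of k and [r] the scalar geometric sums controlling their increments. *)
Lemma nonneg_inv q (e : R) : nonneg q -> 0 < e ->
  exists v, [/\ star v = v, v * (q + e *r 1) = 1 & (q + e *r 1) * v = 1].
Proof.
move=> [sq [t t0 nt]] e0; pose T := t + e; have T0 : 0 < T by rewrite addr_gt0.
have Tn0 : T != 0 by rewrite gt_eqF.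
pose k := T^-1 *r (t *r 1 - q); pose rho := t / T.
have sk : star k = k by rewrite sZ (cs_starB ax) sZ star1 sq.
have rho0 : 0 <= rho by rewrite divr_ge0 ?ltW.
have rho1 : rho < 1 by rewrite ltr_pdivrMr // mul1r ltrDl.
have nk : nrm k <= rho.
  by rewrite cs_normZr_ge0 ?invr_ge0 ?(ltW T0) // mulrC ler_pM2r // invr_gt0.
pose g := fix g n := if n is n'.+1 then 1 + k * g n' else 0.
pose r := fix r n : R := if n is n'.+1 then 1 + rho * r n' else 0.
have gS n : g n.+1 = 1 + k * g n by [].
have rS n : r n.+1 = 1 + rho * r n by [].
have dg n : nrm (g n.+1 - g n) <= r n.+1 - r n.
  elim: n => [|n IH]; first by rewrite /= !mulr0 !addr0 !subr0 norm1_le.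
  rewrite (gS n.+1) [X in nrm (_ - X)]gS (rS n.+1) [X in _ <= _ - X]rS.
  have -> : 1 + rho * r n.+1 - (1 + rho * r n) = rho * (r n.+1 - r n) by ring.
  rewrite opprD addrACA subrr add0r -mulrBr.
  by apply: le_trans (nM _ _) _; exact: ler_pM.
have rB n : r n <= (1 - rho)^-1.
  elim: n => [|n IH]; first by rewrite invr_ge0 subr_ge0 ltW.
  rewrite rS; have : (1 - rho) * (1 - rho)^-1 = 1 by rewrite mulfV // gt_eqF // subr_gt0.
  move: IH; move: (r n) ((1 - rho)^-1) => x y; nra.
have [l gl] := cvgn_bounded_incr ax dg rB.
have kg n : k * g n = g n * k.
  by elim: n => [|n IH]; rewrite ?mulr0 ?mul0r // gS mulrDr mulrDl mulr1 mul1r {1}IH mulrA.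
have kl : k * l = l * k by exact: (cvgn_comm ax gl kg).
have sl : star l = l.
  apply: (cvgn_sa ax gl); elim=> [|n IH]; first exact: cs_star0 ax.
  by rewrite gS sD star1 sM IH sk kg.
have lE : l = 1 + k * l.
  apply: (cvgn_uniq ax (cvgn_shift gl)).
  exact: (cvgnD ax (cvgn_cst ax _) (cvgnM ax (cvgn_cst ax _) gl)).
have qE : q + e *r 1 = T *r (1 - k).
  by rewrite scalerBr scrK // scrDl opprB [RHS]addrC addrA subrK.
exists (T^-1 *r l); rewrite qE !scrM mulVf // mulfV // !scr1; split.
- by rewrite sZ sl.
- by rewrite mulrBr mulr1 -kl {1}lE addrK.
- by rewrite mulrBl mul1r {1}lE addrK.
Qed.

(** All the h + d with 0 < d <= 1 share the norm bound T = |h| + 1, so T - h - d has norm at most T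
    for each of them, and d may tend to 0. *)
Lemma nonneg_closed h : star h = h -> (forall e : R, 0 < e -> nonneg (h + e *r 1)) -> nonneg h.
Proof.
move=> sh he; split=> //; pose T := nrm h + 1.
have T0 : 0 < T by have := n_ge0 h; rewrite /T; lra.
exists T => //; apply/ler_addgt0Pr => e e0.
have [d [d0 d1 de]] : exists d : R, [/\ 0 < d, d <= 1 & d <= e].
  by case: (lerP e 1) => ?; [exists e | exists 1]; split=> //; lra.
have nd : nrm (d *r 1) <= d by rewrite cs_normZr_ge0 ?(ltW d0) //; have := norm1_le; nra.
have h1 : nrm (T *r 1 - (h + d *r 1)) <= T.
  apply: nonneg_norm_subs => //; first exact: he.
  by apply: le_trans (nD _ _) _; rewrite /T; lra.
have -> : T *r 1 - h = T *r 1 - (h + d *r 1) + d *r 1 by rewrite opprD addrA subrK.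
by apply: le_trans (nD _ _) _; lra.
Qed.

(* For b = q + e, the element y = b^{-1/2} p b^{-1/2} satisfies
   y^{k+1} = b^{-1/2} (p b^{-1})^k p b^{-1/2}, and |p b^{-1}| <= 1; hence |y| <= 1. *)
Lemma nonneg_sqrt_mono p q : nonneg p -> nonneg q -> nonneg (q * q - p * p) -> nonneg (q - p).
Proof.
move=> p0 q0 qp; have [sp _] := p0; have [sq _] := q0.
apply: nonneg_closed => [|e e0]; first by rewrite (cs_starB ax) sp sq.
have e1 : nonneg (e *r 1).
  by apply: nonnegZ; [exact: ltW | rewrite -[1]mulr1; apply: nonneg_sqr; exact: star1].
pose b := q + e *r 1; have b0 : nonneg b by exact: nonnegD.
have [v [sv vb bv]] := nonneg_inv q0 e0; rewrite -/b in vb bv.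
have [r [[sr _] rE cr]] := nonneg_sqrt b0.
have rv : v * r = r * v by apply: cr; rewrite vb bv.
(* The inverse square root of [b] is w = r v, where r = b^{1/2} and v = b^{-1}. *)
have [w [rw wr sw ww]] : exists w, [/\ r * w = 1, w * r = 1, star w = w & w * w = v].
  have rrv : r * (r * v) = 1 by rewrite mulrA rE.
  exists (r * v); rewrite -{2 5}rv -!mulrA rE rrv mulr1.
  by split=> //; rewrite sM sr sv rv.
pose y := w * p * w.
have sy : star y = y by rewrite !sM sw sp mulrA.
(* By the identity 1 - (p v)^* (p v) = v (b^2 - p^2) v, it suffices that b^2 - p^2 = (q^2 - p^2) + 2
   e q + e^2 is nonnegative. *)
have npv : nrm (p * v) <= 1.
  have h1 : nrm (star (p * v) * (p * v)) <= 1.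
    apply: nonneg_norm_le; rewrite ?ltr01 //; first exact: nonneg_cstar.
    have -> : 1 *r 1 - star (p * v) * (p * v) = star v * (b * b - p * p) * v.
      by rewrite mulrBr mulrBl sv sM sv sp !mulrA vb mul1r bv scr1.
    apply: nonneg_conj.
    have -> : b * b - p * p = (q * q - p * p) + (e *r q + e *r q + (e * e) *r 1).
      by rewrite mulrDl !mulrDr -!scalerAl -!scalerAr !mulr1 !mul1r scrA
        [in RHS]addrAC !addrA.
    apply: nonnegD => //; apply: nonnegD; last first.
      by rewrite -scrA; apply: nonnegZ => //; exact: ltW.
    by apply: nonnegD; apply: nonnegZ => //; exact: ltW.
  by have := cs_cstar ax (p * v); have := n_ge0 (p * v); nra.
have npvk k : nrm ((p * v) ^+ k) <= 1.
  by elim: k => [|k IH]; rewrite ?norm1_le // exprS; exact: normM_le1.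
have yk k : y ^+ k.+1 = w * (p * v) ^+ k * (p * w).
  elim: k => [|k IH]; first by rewrite expr1 expr0 mulr1 mulrA.
  by rewrite exprSr IH /y [(p * v) ^+ k.+1]exprSr -ww !mulrA.
pose C := nrm w * (nrm p * nrm w).
have C0 : 0 <= C by rewrite !mulr_ge0.
have ny : nrm y <= 1.
  apply: (@pow2_growth_le1 _ _ C) => [|m]; first exact: n_ge0.
  rewrite -norm_sa_pow2 //.
  have h1 : (1 : R) <= (2 ^ m)%:R by rewrite ler1n expn_gt0.
  apply: (@le_trans _ _ C); last by rewrite -[leLHS]mulr1 ler_wpM2l.
  have -> : (2 ^ m)%N = (2 ^ m).-1.+1 by rewrite prednK // expn_gt0.
  rewrite yk; apply: le_trans (nM _ _) _; apply: ler_pM => //; last exact: nM.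
  apply: le_trans (nM _ _) _; rewrite -[leRHS]mulr1; exact: ler_pM.
have -> : q - p + e *r 1 = star r * (1 *r 1 - y) * r.
  rewrite sr scr1 mulrBr mulr1 mulrBl rE /y !mulrA rw mul1r -mulrA wr mulr1.
  by rewrite addrAC.
by apply: nonneg_conj; apply: nonneg_norm_sub.
Qed.

End Unital.

(** * The unitization *)

(** The limit is the supremum of the numbers that are eventually lower bounds of [u], that is, its
    limit inferior. *)
Lemma real_cauchy_cvg (R : realType) (u : nat -> R) :
  (forall e : R, 0 < e -> exists N : nat, forall m n : nat,
      (N <= m)%N -> (N <= n)%N -> `|u m - u n| < e) ->
  exists l : R, forall e : R, 0 < e -> exists N : nat, forall n : nat,
      (N <= n)%N -> `|u n - l| < e.
Proof.
move=> cu.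
pose E : classical_sets.set R := fun x => exists N, forall n, (N <= n)%N -> x <= u n.
have in_E e : 0 < e -> exists N, E (u N - e) /\
    forall n, (N <= n)%N -> u N - e < u n < u N + e.
  move=> /cu [N hN]; have h n : (N <= n)%N -> u N - e < u n < u N + e.
    by move=> /(hN _ _)/(_ (leqnn _)); rewrite ltr_distl.
  by exists N; split=> //; exists N => n /h /andP[/ltW].
have supE : has_sup E.
  have [N [EN hN]] := in_E 1 ltr01.
  split; first by exists (u N - 1).
  exists (u N + 1) => x [M hM].
  have := hM _ (leq_maxl M N); have /andP[_] := hN _ (leq_maxr M N); lra.
exists (sup E) => e e0; have e20 : 0 < e / 2 by lra.
have [N [EN hN]] := in_E _ e20; exists N => n /hN /andP[h1 h2].
have h3 : u N - e / 2 <= sup E by apply: ub_le_sup => //; exact: supE.2.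
have h4 : sup E <= u N + e / 2.
  apply: ge_sup; first exact: supE.1.
  move=> x [M hM]; have := hM _ (leq_maxl M N).
  have /andP[_] := hN _ (leq_maxr M N); lra.
rewrite ltr_distl; apply/andP; split; lra.
Qed.

(** * The real-valued modulus of complex numbers *)

Section ComplexAbs.
Variable R : realType.
Implicit Types z w : R[i].

(** The modulus [|z|] takes values in [R[i]]; its real part carries the same value into [R], where
    the norms live. *)
Definition cabs z : R := complex.Re `|z|.

Lemma cabsE z : (cabs z)%:C = `|z|.
Proof. exact: (RRe_real (normr_real z)). Qed.

Lemma cabs_ge0 z : 0 <= cabs z.
Proof. by rewrite -ler0c cabsE. Qed.

Lemma cabsM z w : cabs (z * w) = cabs z * cabs w.
Proof. by apply: complexI; rewrite rmorphM !cabsE normrM. Qed.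

Lemma cabsD z w : cabs (z + w) <= cabs z + cabs w.
Proof. by rewrite -lecR rmorphD !cabsE ler_normD. Qed.

Lemma cabs_conj z : cabs (z^*)%R = cabs z.
Proof. by apply: complexI; rewrite !cabsE norm_conjC. Qed.

Lemma cabsN z : cabs (- z) = cabs z.
Proof. by apply: complexI; rewrite !cabsE normrN. Qed.

Lemma cabs0 : cabs 0 = 0.
Proof. by apply: complexI; rewrite cabsE normr0. Qed.

Lemma cabs_eq0 z : cabs z = 0 -> z = 0.
Proof. by move=> h; apply/eqP; rewrite -normr_eq0 -cabsE h. Qed.

Lemma cabsV z : z != 0 -> cabs z^-1 * cabs z = 1.
Proof.
by move=> z0; rewrite -cabsM mulVf //; apply: complexI; rewrite cabsE normr1.
Qed.

Lemma cabs_def z : cabs z = Num.sqrt (complex.Re z ^+ 2 + complex.Im z ^+ 2).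
Proof. by rewrite /cabs normc_def. Qed.

Lemma Re_le_cabs z : `|complex.Re z| <= cabs z.
Proof. by rewrite cabs_def -sqrtr_sqr ler_wsqrtr // lerDl sqr_ge0. Qed.

Lemma Im_le_cabs z : `|complex.Im z| <= cabs z.
Proof. by rewrite cabs_def -sqrtr_sqr ler_wsqrtr // lerDr sqr_ge0. Qed.

Lemma cabs_le_ReIm z : cabs z <= `|complex.Re z| + `|complex.Im z|.
Proof.
rewrite cabs_def -[leRHS]ger0_norm ?addr_ge0 // -sqrtr_sqr ler_wsqrtr //.
rewrite -[in leLHS]real_normK ?num_real // -[X in _ + X <= _]real_normK ?num_real //.
by rewrite sqrrD addrAC lerDl mulrn_wge0 // mulr_ge0.
Qed.

Lemma complex_complete : @complete_wrt R R[i] cabs.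
Proof.
move=> u cu.
have [e e0|a ha] := @real_cauchy_cvg R (fun n => complex.Re (u n)).
  have [N hN] := cu e e0; exists N => m n Nm Nn; apply: le_lt_trans (hN m n Nm Nn).
  by rewrite -raddfB; exact: Re_le_cabs.
have [e e0|b hb] := @real_cauchy_cvg R (fun n => complex.Im (u n)).
  have [N hN] := cu e e0; exists N => m n Nm Nn; apply: le_lt_trans (hN m n Nm Nn).
  by rewrite -raddfB; exact: Im_le_cabs.
exists (Complex a b) => e e0; have e20 : 0 < e / 2 by lra.
have [[N hN] [M hM]] := (ha _ e20, hb _ e20); exists (maxn N M) => n.
rewrite geq_max => /andP[/hN h1 /hM h2]; apply: le_lt_trans (cabs_le_ReIm _) _.
by rewrite !raddfB /=; lra.
Qed.

End ComplexAbs.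

(** * Adjoining a unit to A *)

(** The pair (k, a) stands for k + a; the separate name lets the product module receive the
    multiplication [umul]. *)
Definition unitization (R : realType) (A : cstar_algebra R) : Type := (R[i]^o * A)%type.

Section Unitization.
Variables (R : realType) (A : cstar_algebra R).

HB.instance Definition _ := GRing.Lmodule.copy (unitization A) (R[i]^o * A)%type.

Local Notation U := (unitization A).
Local Notation mul := (@ca_mul R A).
Local Notation star := (@ca_star R A).
Local Notation nrm := (@ca_norm R A).
Let ax := ca_ax A.
Implicit Types (u v w : U) (a b : A).

Definition umul u v : U := (u.1 * v.1, u.1 *: v.2 + v.1 *: u.2 + mul u.2 v.2).
Definition uone : U := (1, 0).

Lemma umulA : associative umul.
Proof.
move=> u v w; congr pair => /=; first exact: mulrA.
rewrite !(cs_mulDr ax) !(cs_mulDl ax) !(cs_mulZr ax) !(cs_mulZl ax) (cs_mulA ax).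
rewrite !scalerDr !scalerA (mulrC w.1 u.1) (mulrC w.1 v.1) -!addrA; congr (_ + (_ + _)).
by rewrite addrCA; congr (_ + _); rewrite [RHS]addrCA; congr (_ + _); rewrite [RHS]addrCA.
Qed.

Lemma umul1l : left_id uone umul.
Proof.
by move=> [k a]; rewrite /umul /= mul1r scale1r scaler0 addr0 (cs_mul0l ax) addr0.
Qed.

Lemma umul1r : right_id uone umul.
Proof.
by move=> [k a]; rewrite /umul /= mulr1 scale1r scaler0 add0r (cs_mul0 ax) addr0.
Qed.

Lemma umulDl : left_distributive umul +%R.
Proof.
move=> u v w; congr pair => /=; first exact: mulrDl.
by rewrite scalerDl scalerDr (cs_mulDl ax) [RHS]addrACA; congr (_ + _); rewrite addrACA.
Qed.

Lemma umulDr : right_distributive umul +%R.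
Proof.
move=> u v w; congr pair => /=; first exact: mulrDr.
by rewrite scalerDl scalerDr (cs_mulDr ax) [RHS]addrACA; congr (_ + _); rewrite addrACA.
Qed.

Lemma uone_neq0 : uone != 0.
Proof. by apply/eqP => -[/eqP]; rewrite oner_eq0. Qed.

HB.instance Definition _ := GRing.Zmodule_isNzRing.Build U
  umulA umul1l umul1r umulDl umulDr uone_neq0.

Lemma uscalerAl (k : R[i]) u v : k *: (u * v) = (k *: u) * v.
Proof.
congr pair => /=; first exact: mulrA.
by rewrite !scalerDr !scalerA (cs_mulZl ax) (mulrC v.1).
Qed.

HB.instance Definition _ := GRing.Lmodule_isLalgebra.Build R[i] U uscalerAl.

Lemma uscalerAr (k : R[i]) u v : k *: (u * v) = u * (k *: v).
Proof.
congr pair => /=; first exact: mulrCA.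
by rewrite !scalerDr !scalerA (cs_mulZr ax) (mulrC u.1).
Qed.

HB.instance Definition _ := GRing.Lalgebra_isAlgebra.Build R[i] U uscalerAr.

(** Left multiplication by k + a on the ideal A, whose operator norm enters [unorm]. *)
Definition uact u b : A := u.1 *: b + mul u.2 b.
Definition ustar u : U := ((u.1^*)%R, star u.2).
(* Including |u.1| makes the operator seminorm a norm even when A already has a
   unit. *)
Definition unorm_set u : classical_sets.set R := fun r =>
  r = cabs u.1 \/ exists b, nrm b <= 1 /\ r = nrm (uact u b).
Definition unorm u : R := sup (unorm_set u).

Lemma cs_normZ_cabs (k : R[i]) a : nrm (k *: a) = cabs k * nrm a.
Proof. by apply: complexI; rewrite (cs_normZ ax) -cabsE -rmorphM. Qed.

Lemma uactD u v b : uact (u + v) b = uact u b + uact v b.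
Proof. by rewrite /uact scalerDl (cs_mulDl ax) addrACA. Qed.

Lemma uactZ (k : R[i]) u b : uact (k *: u) b = k *: uact u b.
Proof. by rewrite /uact /= scalerDr scalerA (cs_mulZl ax). Qed.

Lemma uactZr (k : R[i]) u b : uact u (k *: b) = k *: uact u b.
Proof. by rewrite /uact scalerDr !scalerA (cs_mulZr ax) mulrC. Qed.

Lemma uactM u v b : uact (u * v) b = uact u (uact v b).
Proof.
rewrite /uact /= !(cs_mulDl ax) !(cs_mulZl ax) (cs_mulDr ax) (cs_mulZr ax).
by rewrite scalerDr scalerA (cs_mulA ax) !addrA.
Qed.

Lemma uact_star u a b : mul (star (uact u a)) b = mul (star a) (uact (ustar u) b).
Proof.
rewrite /uact (cs_starD ax) (cs_starZ ax) (cs_starM ax) (cs_mulDl ax) (cs_mulDr ax).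
by rewrite (cs_mulZl ax) (cs_mulZr ax) (cs_mulA ax).
Qed.

Lemma uact_bound u b : nrm (uact u b) <= (cabs u.1 + nrm u.2) * nrm b.
Proof.
rewrite mulrDl -cs_normZ_cabs; apply: le_trans (cs_normD ax _ _) _.
by rewrite lerD2l (cs_normM ax).
Qed.

Lemma unorm_sup u : has_sup (unorm_set u).
Proof.
split; first by exists (cabs u.1); left.
exists (cabs u.1 + nrm u.2) => _ [->|[b [b1 ->]]].
  by rewrite lerDl (cs_norm_ge0 ax).
apply: le_trans (uact_bound _ _) _; rewrite -[leRHS]mulr1 ler_wpM2l //.
by rewrite addr_ge0 ?cabs_ge0 ?(cs_norm_ge0 ax).
Qed.

Lemma cabs_le_unorm u : cabs u.1 <= unorm u.
Proof. by apply: ub_le_sup; [exact: (unorm_sup u).2 | left]. Qed.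

Lemma unorm_ge0 u : 0 <= unorm u.
Proof. exact: le_trans (cabs_ge0 _) (cabs_le_unorm u). Qed.

Lemma uact_le u b : nrm (uact u b) <= unorm u * nrm b.
Proof.
have := cs_norm_ge0 ax b; rewrite le_eqVlt => /predU1P [b0|b0].
  by rewrite (cs_norm_eq0 ax (esym b0)) /uact scaler0 (cs_mul0 ax) addr0 (cs_norm0 ax) mulr0.
have bV : 0 <= (nrm b)^-1 by rewrite invr_ge0 ltW.
rewrite -ler_pdivrMr // mulrC -{1}(ger0_norm bV) -(cs_normZr ax) -uactZr.
apply: ub_le_sup; first exact: (unorm_sup u).2.
right; exists ((nrm b)^-1%:C *: b); split=> //.
by rewrite (cs_normZr ax) ger0_norm // mulVf // gt_eqF.
Qed.

Lemma unorm_lub u (M : R) : cabs u.1 <= M -> (forall b, nrm (uact u b) <= M * nrm b) ->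
  unorm u <= M.
Proof.
move=> h1 h2; apply: ge_sup; first exact: (unorm_sup u).1.
move=> _ [->|[b [b1 ->]]] //; apply: le_trans (h2 b) _.
by rewrite -[leRHS]mulr1 ler_wpM2l // (le_trans (cabs_ge0 _) h1).
Qed.

Lemma unorm_eq0 u : unorm u = 0 -> u = 0.
Proof.
move=> u0; have h1 : u.1 = 0.
  by apply: cabs_eq0; apply/le_anti; rewrite cabs_ge0 andbT -u0 cabs_le_unorm.
suff h2 : u.2 = 0 by rewrite [u]surjective_pairing h1 h2.
(* With scalar part 0, u = (0, c) acts as zero on c^*, so c c^* = 0 and the C*-identity gives c^* =
   0. *)
rewrite -(cs_starK ax u.2) -(cs_star0 ax); congr ca_star.
apply: (cs_cstar_eq0 ax); rewrite (cs_starK ax); apply: (cs_norm_eq0 ax).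
apply/le_anti; rewrite (cs_norm_ge0 ax) andbT.
by have := uact_le u (star u.2); rewrite u0 mul0r /uact h1 scale0r add0r.
Qed.

Lemma unormD u v : unorm (u + v) <= unorm u + unorm v.
Proof.
apply: unorm_lub => [|b].
  by apply: le_trans (cabsD _ _) _; apply: lerD; exact: cabs_le_unorm.
rewrite uactD mulrDl; apply: le_trans (cs_normD ax _ _) _.
by apply: lerD; exact: uact_le.
Qed.

Lemma unormZ (k : R[i]) u : unorm (k *: u) = cabs k * unorm u.
Proof.
have le c v : unorm (c *: v) <= cabs c * unorm v.
  apply: unorm_lub => [|b].
    by rewrite /= cabsM ler_wpM2l ?cabs_ge0 // cabs_le_unorm.
  by rewrite uactZ cs_normZ_cabs -mulrA ler_wpM2l ?cabs_ge0 // uact_le.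
apply/le_anti; rewrite le /=; have [->|k0] := eqVneq k 0.
  by rewrite cabs0 mul0r unorm_ge0.
have := le k^-1 (k *: u); rewrite scalerA mulVf // scale1r => h.
apply: le_trans (ler_wpM2l (cabs_ge0 k) h) _.
by rewrite mulrA [cabs k * _]mulrC cabsV // mul1r.
Qed.

Lemma unormM u v : unorm (u * v) <= unorm u * unorm v.
Proof.
apply: unorm_lub => [|b].
  by rewrite /= cabsM ler_pM ?cabs_ge0 ?cabs_le_unorm.
rewrite uactM; apply: le_trans (uact_le _ _) _.
by rewrite -mulrA ler_wpM2l ?unorm_ge0 // uact_le.
Qed.

Lemma ustarK : involutive ustar.
Proof. by move=> [k a]; rewrite /ustar /= conjCK (cs_starK ax). Qed.

Lemma ustarM u v : ustar (u * v) = ustar v * ustar u.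
Proof.
congr pair => /=; first by rewrite rmorphM mulrC.
by rewrite !(cs_starD ax) !(cs_starZ ax) (cs_starM ax) [X in X + _]addrC.
Qed.

Lemma unorm_cstar_ge u : unorm u ^+ 2 <= unorm (ustar u * u).
Proof.
set N := unorm (ustar u * u); have N0 : 0 <= N by exact: unorm_ge0.
rewrite -(sqr_sqrtr N0) ler_sqr ?nnegrE ?sqrtr_ge0 ?unorm_ge0 //.
apply: unorm_lub => [|b].
  rewrite -ler_sqr ?nnegrE ?sqrtr_ge0 ?cabs_ge0 // sqr_sqrtr // expr2.
  by rewrite -{1}cabs_conj -cabsM; exact: cabs_le_unorm (ustar u * u).
have b0 := cs_norm_ge0 ax b.
rewrite -ler_sqr ?nnegrE ?mulr_ge0 ?sqrtr_ge0 ?(cs_norm_ge0 ax) // exprMn sqr_sqrtr //.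
(* |u b|^2 = |b^* (u^* u b)| <= |b| |u^* u| |b|. *)
rewrite -(cs_cstar ax) uact_star -uactM; apply: le_trans (cs_normM ax _ _) _.
by rewrite (cs_norm_star ax) expr2 mulrCA ler_wpM2l // uact_le.
Qed.

Lemma unorm_star u : unorm (ustar u) = unorm u.
Proof.
have le v : unorm v <= unorm (ustar v).
  have := unorm_ge0 v; rewrite le_eqVlt => /predU1P [<-|v0]; first exact: unorm_ge0.
  have := le_trans (unorm_cstar_ge v) (unormM _ _).
  by rewrite expr2 ler_pM2r.
by apply/le_anti; rewrite le -{2}(ustarK u) le.
Qed.

Lemma unorm_le u : unorm u <= cabs u.1 + nrm u.2.
Proof. by apply: unorm_lub; [rewrite lerDl (cs_norm_ge0 ax) | exact: uact_bound]. Qed.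

(** The lower bound comes from testing on b = a^*, where |a a^*| = |a|^2 = |a| |b|. *)
Lemma unorm_inj a : unorm ((0, a) : U) = nrm a.
Proof.
apply/le_anti/andP; split; first by have := unorm_le (0, a); rewrite cabs0 add0r.
have := cs_norm_ge0 ax a; rewrite [0 <= _]le_eqVlt.
move=> /predU1P [<-|a0]; first exact: unorm_ge0.
have := uact_le (0, a) (star a); rewrite /uact scale0r add0r /= (cs_norm_star ax).
have := cs_cstar ax (star a); rewrite (cs_starK ax) (cs_norm_star ax) => ->.
by rewrite expr2 ler_pM2r.
Qed.

(** Subtract from [u] its scalar part, which is bounded by [unorm u]. This makes the A-components of
    a Cauchy sequence Cauchy. *)
Lemma snd_le_unorm u : nrm u.2 <= unorm u + unorm u.
Proof.
have -> : nrm u.2 = unorm (u + (- u.1) *: (1 : U)).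
  rewrite -unorm_inj; congr unorm; apply/esym; congr pair => /=.
    by rewrite [_ *: _]mulr1 subrr.
  by rewrite scaler0 addr0.
apply: le_trans (unormD _ _) _; rewrite lerD2l unormZ.
have -> : unorm (1 : U) = 1.
  have c1 : cabs (1 : R[i]) = 1 by apply: complexI; rewrite cabsE normr1.
  apply/le_anti/andP; split; last by rewrite -[leLHS]c1; exact: cabs_le_unorm 1.
  apply: unorm_lub => [|b]; first by rewrite /= c1.
  by rewrite /uact /= scale1r (cs_mul0l ax) addr0 mul1r.
by rewrite mulr1 cabsN; exact: cabs_le_unorm.
Qed.

Lemma unitization_is_cstar : is_cstar (A := U) *%R ustar unorm.
Proof.
split.
- exact: mulrA.
- exact: mulrDl.
- exact: mulrDr.
- by move=> k u v; rewrite scalerAl.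
- by move=> k u v; rewrite scalerAr.
- by move=> u v; congr pair => /=; rewrite ?rmorphD ?(cs_starD ax).
- by move=> k u; congr pair => /=; rewrite ?rmorphM ?(cs_starZ ax).
- exact: ustarK.
- exact: ustarM.
- exact: unorm_eq0.
- exact: unorm_ge0.
- exact: unormD.
- by move=> k u; rewrite unormZ -cabsE -rmorphM.
- exact: unormM.
- move=> u; apply/le_anti; rewrite unorm_cstar_ge andbT.
  by apply: le_trans (unormM _ _) _; rewrite unorm_star.
- move=> u cu.
  have [e e0|k hk] := @complex_complete R (fun n => (u n).1).
    have [N hN] := cu e e0; exists N => m n Nm Nn; apply: le_lt_trans (hN m n Nm Nn).
    exact: (cabs_le_unorm (u m - u n)).
  have [e e0|a ha] := cs_complete ax (u := fun n => (u n).2).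
    have e20 : 0 < e / 2 by lra.
    have [N hN] := cu _ e20; exists N => m n Nm Nn.
    by have := hN m n Nm Nn; have := snd_le_unorm (u m - u n); move=> /=; lra.
  exists (k, a) => e e0; have e20 : 0 < e / 2 by lra.
  have [[N hN] [M hM]] := (hk _ e20, ha _ e20); exists (maxn N M) => n.
  rewrite geq_max => /andP[/hN h1 /hM h2].
  by apply: le_lt_trans (unorm_le _) _; move=> /=; lra.
Qed.

End Unitization.

(** * Positive elements of A seen in the unitization *)

Section PositiveCone.
Variables (R : realType) (A : cstar_algebra R).
Local Notation U := (unitization A).
Local Notation mul := (@ca_mul R A).
Local Notation star := (@ca_star R A).
Local Notation nrm := (@ca_norm R A).
Let ax := ca_ax A.
Let axU := unitization_is_cstar A.
Local Notation nonnegU := (nonneg (@ustar R A) (@unorm R A)).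
Implicit Types (a b h p q : A).

Definition uinj a : U := (0, a).

Lemma uinjB a b : uinj (a - b) = uinj a - uinj b.
Proof. by congr pair; rewrite /= subr0. Qed.

Lemma uinjZ (k : R[i]) a : uinj (k *: a) = k *: uinj a.
Proof. by congr pair; rewrite /= scaler0. Qed.

Lemma uinjM a b : uinj (mul a b) = uinj a * uinj b.
Proof. by congr pair; rewrite /= ?mul0r // !scale0r !add0r. Qed.

Lemma uinj_star a : uinj (star a) = ustar (uinj a).
Proof. by congr pair; rewrite /= conjC0. Qed.

(** A root taken in the unitization lies in A, because the scalar part of a square is the square of
    the scalar part; taking a second root r exhibits p as r^* r. *)
Lemma cpos_sqrt_nonneg h : nonnegU (uinj h) -> exists p, cpos p /\ mul p p = h.
Proof.
move=> /(nonneg_sqrt axU)[p [p0 pE _]]; have [r [[sr _] rE _]] := nonneg_sqrt axU p0.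
have fst_eq0 (u v : U) : u * u = v -> v.1 = 0 -> u.1 = 0.
  by move=> <- /eqP; rewrite /= mulf_eq0 orbb => /eqP.
have p1 : p.1 = 0 by exact: fst_eq0 pE _.
have r1 : r.1 = 0 by exact: fst_eq0 rE _.
have pI : p = uinj p.2 by rewrite [LHS]surjective_pairing p1.
have rI : r = uinj r.2 by rewrite [LHS]surjective_pairing r1.
have sr2 : star r.2 = r.2 := congr1 snd sr.
exists p.2; split.
  exists r.2; rewrite sr2; have := congr1 snd rE.
  by rewrite rI -uinjM.
by have := congr1 snd pE; rewrite pI -uinjM.
Qed.

Lemma cpos_sa p : cpos p -> star p = p.
Proof. by move=> [c ->]; rewrite (cs_starM ax) (cs_starK ax). Qed.

(** The bridge along which the results on [nonneg] descend to the elements c^* c of A. *)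
Lemma cpos_nonneg a : cpos a <-> nonnegU (uinj a).
Proof.
split=> [[c ->]|/cpos_sqrt_nonneg [p [p0 <-]]].
  by rewrite uinjM uinj_star; exact: nonneg_cstar axU _.
by exists p; rewrite cpos_sa.
Qed.

Lemma cpos_sqrt h : cpos h -> exists p, cpos p /\ mul p p = h.
Proof. by move/cpos_nonneg/cpos_sqrt_nonneg. Qed.

Lemma cposZ (t : R) a : 0 <= t -> cpos a -> cpos (t%:C *: a).
Proof. by move=> t0; rewrite !cpos_nonneg uinjZ; exact: (nonnegZ axU t0). Qed.

Lemma cge_norm_le a b : cpos a -> cge b a -> nrm a <= nrm b.
Proof.
rewrite /cge !cpos_nonneg uinjB -!unorm_inj; exact: (nonneg_le_norm axU).
Qed.

Lemma cpos_sqrt_mono p q : cpos p -> cpos q -> cge (mul q q) (mul p p) -> cge q p.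
Proof.
rewrite /cge !cpos_nonneg !uinjB !uinjM; exact: (nonneg_sqrt_mono axU).
Qed.

(** The difference is a^* (M - h) a with M - h nonnegative, formed in the unitization, where the
    scalar M is an element. *)
Lemma conj_le_norm h a (M : R) : cpos h -> 0 < M -> nrm h <= M ->
  cge (M%:C *: mul (star a) a) (mul (star a) (mul h a)).
Proof.
move=> h0 M0 hM; apply/cpos_nonneg; rewrite uinjB uinjZ !uinjM uinj_star.
have -> : M%:C *: (ustar (uinj a) * uinj a) - ustar (uinj a) * (uinj h * uinj a) =
    ustar (uinj a) * (M%:C *: 1 - uinj h) * uinj a.
  by rewrite mulrBr mulrBl -scalerAr mulr1 scalerAl mulrA.
apply: (nonneg_conj axU); apply: (nonneg_norm_sub axU) => //.
  by rewrite -uinj_star cpos_sa.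
by rewrite unorm_inj.
Qed.

End PositiveCone.

(** * Orthogonality in Hilbert modules *)

Section Orthogonality.
Variables (R : realType) (A : cstar_algebra R) (X : hilbert_module A).
Local Notation mul := (@ca_mul R A).
Local Notation star := (@ca_star R A).
Local Notation nrm := (@ca_norm R A).
Local Notation ip := (@hm_ip R A X).
Local Notation act := (@hm_act R A X).
Let ax := ca_ax A.
Let hx := hm_ax X.
Implicit Types (x y z : X) (a : A).

Lemma hm_ipDl x y z : ip (x + y) z = ip x z + ip y z.
Proof.
by rewrite (hm_ip_sym hx) (hm_ipD hx) (cs_starD ax) -!(hm_ip_sym hx).
Qed.

Lemma hm_ip0l y : ip 0 y = 0.
Proof.
rewrite (hm_ip_sym hx) -(scale0r (0 : X)) (hm_ipZ hx) scale0r; exact: cs_star0 ax.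
Qed.

Lemma hm_ip_actl x y a : ip (act x a) y = mul (star a) (ip x y).
Proof. by rewrite (hm_ip_sym hx) (hm_ipA hx) (cs_starM ax) -(hm_ip_sym hx). Qed.

Lemma horth_sym x y : horth x y -> horth y x.
Proof. by rewrite /horth (hm_ip_sym hx y) => ->; exact: cs_star0 ax. Qed.

(** Existence of a positive square root of <z,z> is what gives the epsilon choice in [habs] its
    meaning. *)
Lemma habsP z : is_abs z (habs z).
Proof.
apply: ClassicalEpsilon.epsilon_spec.
by have [p [p0 pE]] := cpos_sqrt (hm_ip_pos hx z); exists p.
Qed.

Lemma habs_sq z : mul (habs z) (habs z) = ip z z.
Proof. by case: (habsP z). Qed.

Lemma habs_pos z : cpos (habs z).
Proof. by case: (habsP z). Qed.

Lemma habs_norm_sqr z : nrm (habs z) ^+ 2 = nrm (ip z z).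
Proof. by rewrite -habs_sq (cs_sa_sqr ax) ?cpos_sa //; exact: habs_pos. Qed.

Lemma hnorm_le z w : (hnorm z <= hnorm w) = (nrm (ip z z) <= nrm (ip w w)).
Proof. by rewrite /hnorm ler_sqrt // (cs_norm_ge0 ax). Qed.

(** The cross terms vanish, so the difference is <y,y>. *)
Lemma horth_cge x y a : horth x y ->
  cge (ip (act x a + y) (act x a + y)) (ip (act x a) (act x a)).
Proof.
move=> xy; have e1 : ip (act x a) y = 0 by rewrite hm_ip_actl xy (cs_mul0 ax).
have e2 := horth_sym e1; rewrite /cge hm_ipDl !(hm_ipD hx) e1 e2 addr0 add0r addrAC.
by rewrite subrr add0r; exact: hm_ip_pos hx _.
Qed.

(* With a = <x,y>, P = a^*<x,x>a and Q = a^*a, the hypothesis at - t a reads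
   |t^2 P| <= |t^2 P - 2 t Q + <y,y>|, where P <= M Q for M > |<x,x>|; letting t
   grow forces P = <xa,xa> = 0. *)
Lemma hnorm_le_horth x y :
  (forall a, hnorm (act x a) <= hnorm (act x a + y)) -> horth x y.
Proof.
move=> H; set a := ip x y; pose P := ip (act x a) (act x a).
pose Q := mul (star a) a; pose Y := ip y y.
pose M := nrm (ip x x) + 1.
have M0 : 0 < M by rewrite ltr_wpDl ?(cs_norm_ge0 ax).
have P0 : cpos P by exact: hm_ip_pos hx _.
have PE : P = mul (star a) (mul (ip x x) a) by rewrite /P hm_ip_actl (hm_ipA hx).
have PQ : cpos (M%:C *: Q - P).
  rewrite PE; apply: conj_le_norm => //; first exact: hm_ip_pos hx _.
  by rewrite lerDl.
(* Since -2 t Q <= -(2 t / M) P, the norm inequality becomes t^2 |P| <= (t^2 - 2 t / M) |P| + |Y|;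
   the condition t >= 2 / M keeps this coefficient nonnegative. *)
have key (t : R) : 2 / M <= t -> 2 * t / M * nrm P <= nrm Y.
  move=> tM; have t0 : 0 <= t by apply: le_trans tM; rewrite divr_ge0 // ltW.
  pose z := act x ((- t)%:C *: a).
  have zE : z = (- t)%:C *: act x a by rewrite /z (hm_actZr hx).
  have ipZl (c : R) u v : ip (c%:C *: u) v = c%:C *: ip u v.
    by rewrite (hm_ip_sym hx) (hm_ipZ hx) (cs_starZr ax) -(hm_ip_sym hx).
  have zz : ip z z = (t ^+ 2)%:C *: P.
    by rewrite zE (hm_ipZ hx) ipZl scalerA -rmorphM mulrNN -expr2.
  have zy : ip z y = (- t)%:C *: Q by rewrite zE ipZl hm_ip_actl.
  have yz : ip y z = (- t)%:C *: Q.
    by rewrite (hm_ip_sym hx) zy (cs_starZr ax) (cs_starM ax) (cs_starK ax).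
  have wE : ip (z + y) (z + y) = (t ^+ 2)%:C *: P - (2 * t)%:C *: Q + Y.
    have -> : (2 * t)%:C *: Q = - ((- t)%:C *: Q + (- t)%:C *: Q).
      by rewrite -scalerDl -rmorphD -scaleNr -rmorphN; congr (_%:C *: _); ring.
    by rewrite hm_ipDl !(hm_ipD hx) zz zy yz opprK !addrA.
  have c0 : 0 <= t ^+ 2 - 2 * t / M.
    have -> : t ^+ 2 - 2 * t / M = t * (t - 2 / M) by ring.
    by rewrite mulr_ge0 // subr_ge0.
  have h1 : nrm (ip (z + y) (z + y)) <= nrm ((t ^+ 2 - 2 * t / M)%:C *: P + Y).
    apply: cge_norm_le; first exact: hm_ip_pos hx _.
    have tM0 : 0 <= 2 * t / M by rewrite divr_ge0 ?mulr_ge0 // ltW.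
    have := cposZ tM0 PQ; rewrite scalerBr scalerA -rmorphM divfK ?gt_eqF // => h.
    rewrite /cge wE; congr cpos: h.
    rewrite opprD addrACA subrr addr0 rmorphB scalerBl opprB.
    by rewrite addrAC addrCA subrr addr0 addrC.
  have h2 := cs_normD ax ((t ^+ 2 - 2 * t / M)%:C *: P) Y.
  have := H ((- t)%:C *: a); rewrite hnorm_le -/z zz (cs_normZr ax) => h3.
  move: h2; rewrite (cs_normZr ax) (ger0_norm c0).
  move: h3; rewrite ger0_norm ?sqr_ge0 // => h3 h2.
  by have := le_trans h3 (le_trans h1 h2); rewrite mulrBl; lra.
have nP : nrm P = 0.
  apply/eqP; case: eqP => // /eqP nP0.
  have nP1 : 0 < nrm P by rewrite lt_neqAle eq_sym nP0 (cs_norm_ge0 ax).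
  have Y0 : 0 <= nrm Y by exact: cs_norm_ge0 ax _.
  (* This value of t turns the left side of [key] into 4 |P| / M^2 + 2 |Y|, which exceeds |Y| when
     |P| > 0. *)
  have := key (2 / M + M * nrm Y / nrm P).
  have -> : 2 * (2 / M + M * nrm Y / nrm P) / M * nrm P = 4 / M ^+ 2 * nrm P + 2 * nrm Y.
    by field; rewrite nP0 gt_eqF.
  rewrite lerDl !mulr_ge0 ?invr_ge0 ?(ltW M0) ?(ltW nP1) // => /(_ isT).
  have : 0 < 4 / M ^+ 2 * nrm P by rewrite mulr_gt0 // divr_gt0 // exprn_gt0.
  lra.
have xa0 : act x a = 0 by apply: (hm_ip_eq0 hx); exact: cs_norm_eq0 ax _ nP.
(* Here a^* a = a^* <x,y> = <xa,y> = 0. *)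
by apply: (cs_cstar_eq0 ax); rewrite -hm_ip_actl xa0 hm_ip0l.
Qed.

(** Proved as a cycle: orthogonality gives the inequality of squares, then of moduli, then of norms,
    which returns to orthogonality. *)
Lemma horth_equiv x y :
  let sq (p : A) := mul p p in
  [/\ (forall a, cge (sq (habs (act x a + y))) (sq (habs (act x a)))) <-> horth x y,
      (forall a, cge (habs (act x a + y)) (habs (act x a))) <-> horth x y &
      (forall a, hnorm (act x a + y) >= hnorm (act x a)) <-> horth x y].
Proof.
move=> sq.
have h41 : horth x y -> forall a, cge (sq (habs (act x a + y))) (sq (habs (act x a))).
  by move=> xy a; rewrite /sq !habs_sq; exact: horth_cge.
have h12 (h : forall a, cge (sq (habs (act x a + y))) (sq (habs (act x a)))) a :
    cge (habs (act x a + y)) (habs (act x a)).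
  by apply: cpos_sqrt_mono (h a); exact: habs_pos.
have h23 (h : forall a, cge (habs (act x a + y)) (habs (act x a))) a :
    hnorm (act x a) <= hnorm (act x a + y).
  rewrite hnorm_le -!habs_norm_sqr ler_sqr ?nnegrE ?(cs_norm_ge0 ax) //.
  by apply: cge_norm_le (h a); exact: habs_pos.
have h34 := @hnorm_le_horth x y.
by split; split=> [h|/h41 h] //; auto.
Qed.

End Orthogonality.

Unset Implicit Arguments.

Theorem theorem2p4 (R : realType) (A : cstar_algebra R) (X : hilbert_module A)
    (x y : X) :
  let act := @hm_act R A X in
  let sq (p : A) := ca_mul p p in
  let c1 := forall a : A,
      cge (sq (habs (act x a + y))) (sq (habs (act x a))) in
  let c2 := forall a : A, cge (habs (act x a + y)) (habs (act x a)) in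
  let c3 := forall a : A, hnorm (act x a + y) >= hnorm (act x a) in
  let c4 := horth x y in
  let c5 := forall a : A,
      cge (sq (habs (act y a + x))) (sq (habs (act y a))) in
  let c6 := forall a : A, cge (habs (act y a + x)) (habs (act y a)) in
  let c7 := forall a : A, hnorm (act y a + x) >= hnorm (act y a) in
  (c1 <-> c4) /\ (c2 <-> c4) /\ (c3 <-> c4) /\ (c5 <-> c4) /\
  (c6 <-> c4) /\ (c7 <-> c4).
Proof.
(* The last three conditions are the first three with x and y exchanged, so they amount to <y,x> =
   0. *)
have sym : horth y x <-> horth x y by split; exact: horth_sym.
move=> act sq c1 c2 c3 c4 c5 c6 c7.
have [h1 h2 h3] := horth_equiv x y; have [h5 h6 h7] := horth_equiv y x.
by do !split; rewrite /c5 /c6 /c7 ?h5 ?h6 ?h7 /c4; tauto.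
Qed.
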